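(* For all integers $s\ge 1$ and $D\ge 1$ there exist a multipartite graph $G$ and an $sD$-thick partition $\mathcal{P}$ of $G$ such that $\overline{D}_{\mathcal{P}}(G)=D$, $\Gamma_{\mathcal{P}}(G)=1$, and $G$ has no independent transversal blow-up of size $s$ with respect to $\mathcal{P}$.
   Context: All graphs are finite and simple. A multipartite graph $G$ with partition $\mathcal{P}=(V_1,\ldots,V_r)$ is a graph whose vertex set is the disjoint union of the blocks $V_1,\ldots,V_r$, each of which is an independent set of $G$. The partition $\mathcal{P}$ is $x$-thick if $|V_i|\ge x$ for every $i\in[r]$. The average degree of a block is $\overline{d}_G(V_i)=\frac{1}{|V_i|}\sum_{v\in V_i}d_G(v)$, and the maximum block average degree is $\overline{D}_{\mathcal{P}}(G)=\max_{i\in[r]}\overline{d}_G(V_i)$. The local degree is $\Gamma_{\mathcal{P}}(G)=\max_{v\in V(G)}\max_{i\in[r]}d_G(v,V_i)$, where $d_G(v,V_i)$ is the number of neighbours of $v$ in $V_i$. An independent transversal blow-up of size $s$ with respect to $\mathcal{P}$ is an independent set of $G$ containing exactly $s$ vertices from each block $V_i$. *)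

(* Defs.v *)
From mathcomp Require Import all_boot all_order all_algebra.

Set Implicit Arguments.
Unset Strict Implicit.
Unset Printing Implicit Defensive.

Import GRing.Theory Num.Theory.

Record sgraph := SGraph {
  vertex :> finType;
  adj : rel vertex;
  adj_sym : symmetric adj;
  adj_irrefl : irreflexive adj
}.

Section Degrees.
Variable G : sgraph.
Implicit Types (v : G) (A : {set G}).

Definition degree_in v A : nat := #|[set w in A | adj v w]|.

Definition degree v : nat := degree_in v [set: G].

Definition independent A : Prop :=
  forall x y, x \in A -> y \in A -> ~~ adj x y.

Definition avg_degree A : rat :=
  ((\sum_(v in A) degree v)%N%:R / #|A|%:R)%R.

End Degrees.

Section Multipartite.
Variables (G : sgraph) (r : nat) (P : 'I_r -> {set G}).

Definition multipartition : Prop :=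
  [/\ \bigcup_(i < r) P i = [set: G],
      forall i j : 'I_r, i != j -> [disjoint P i & P j]
    & forall i : 'I_r, independent (P i)].

Definition thick (x : nat) : Prop := forall i : 'I_r, x <= #|P i|.

(* Average degrees are nonnegative, so starting the maximum at 0 is harmless;
   it only gives the value 0 when r = 0. *)
Definition max_block_avg_degree : rat :=
  \big[Num.max/0%R]_(i < r) avg_degree (P i).

Definition local_degree : nat :=
  \max_(v : G) \max_(i < r) degree_in v (P i).

Definition independent_transversal_blowup (s : nat) (S : {set G}) : Prop :=
  independent S /\ forall i : 'I_r, #|S :&: P i| = s.

End Multipartite.

(* Main.v *)
(** Take [D.+1] blocks, each a copy of the same [s * D] colours, and join two
    vertices when they carry the same colour in different blocks: the graph is
    a disjoint union of [s * D] cliques of size [D.+1], so all degrees are [D].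
    An independent set uses each colour at most once, hence has at most [s * D]
    vertices, fewer than the [s * (D.+1)] vertices of a blow-up of size [s]. *)
Require Import Defs.
From mathcomp Require Import all_boot all_order all_algebra.

Import GRing.Theory Num.Theory.

Section CliqueUnion.
Variables r m : nat.

Definition clique_adj : rel ('I_r * 'I_m) :=
  fun x y => (x.1 != y.1) && (x.2 == y.2).

Lemma clique_adj_sym : symmetric clique_adj.
Proof. by move=> x y; rewrite /clique_adj eq_sym [x.2 == _]eq_sym. Qed.

Lemma clique_adj_irrefl : irreflexive clique_adj.
Proof. by move=> x; rewrite /clique_adj eqxx. Qed.

Definition clique_union : sgraph := SGraph clique_adj_sym clique_adj_irrefl.

Definition clique_block (i : 'I_r) : {set clique_union} :=
  [set v : 'I_r * 'I_m | v.1 == i].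

Lemma in_clique_block i v : (v \in clique_block i) = (v.1 == i).
Proof. by rewrite inE. Qed.

Lemma clique_blockE i :
  clique_block i = [set ((i, c) : clique_union) | c in 'I_m].
Proof.
apply/setP=> -[j c]; rewrite in_clique_block; apply/eqP/imsetP => /= [->|].
  by exists c.
by case=> d _ [].
Qed.

Lemma card_clique_block i : #|clique_block i| = m.
Proof. by rewrite clique_blockE card_imset ?card_ord // => c d []. Qed.

Lemma clique_multipartition : multipartition clique_block.
Proof.
split=> [|i j neq_ij|i x y].
- apply/setP=> v; rewrite [RHS]inE; apply/bigcupP.
  by exists v.1; rewrite ?in_clique_block.
- apply/pred0P=> v /=; rewrite !in_clique_block.
  by apply: contraNF neq_ij => /andP[/eqP <- /eqP <-].
- by rewrite !in_clique_block /= /clique_adj => /eqP-> /eqP->; rewrite eqxx.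
Qed.

(** The only candidate neighbour in block [i] is [(i, v.2)], the vertex there with the colour of
    [v]; it fails exactly when [i] is the block of [v]. *)
Lemma clique_degree_in (v : clique_union) i :
  degree_in v (clique_block i) = (v.1 != i).
Proof.
rewrite /degree_in; have [vi|vi] := eqVneq v.1 i.
  apply/eqP; rewrite cards_eq0; apply/eqP/setP=> w.
  rewrite [LHS]inE in_set0 in_clique_block /= /clique_adj vi eq_sym.
  by case: eqP.
rewrite -[RHS](cards1 ((i, v.2) : clique_union)); apply: eq_card => -[j c].
rewrite [LHS]inE in_clique_block in_set1 /= /clique_adj /=.
rewrite -pair_eqE /= [c == _]eq_sym.
by case: eqP => // ->; rewrite vi.
Qed.

(** Used twice: on a neighbourhood, to get degrees, and on a blow-up, to get its size. *)
Lemma sum_card_clique_block (A : {set clique_union}) :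
  #|A| = \sum_(i < r) #|A :&: clique_block i|.
Proof.
rewrite -sum1_card (partition_big (fun v : clique_union => v.1) xpredT) //=.
apply: eq_bigr => i _; rewrite -sum1_card; apply: eq_bigl => v.
by rewrite [RHS]inE in_clique_block.
Qed.

Lemma clique_degree (v : clique_union) : degree v = r.-1.
Proof.
rewrite /degree /degree_in sum_card_clique_block.
under eq_bigr => i _.
  have -> : #|[set w in [set: clique_union] | adj v w] :&: clique_block i|
            = degree_in v (clique_block i).
    by apply: eq_card => w; rewrite !inE andbC.
  rewrite clique_degree_in; over.
(* The truth values [v.1 != i] sum to the number of blocks other than that of [v]. *)
rewrite -big_mkcond /= sum1_card -[in RHS](card_ord r).
by rewrite -(cardC1 v.1); apply: eq_card => i; rewrite !inE eq_sym.
Qed.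

Lemma clique_avg_degree i :
  0 < m -> avg_degree (clique_block i) = (r.-1)%:R%R.
Proof.
move=> m_gt0; rewrite /avg_degree.
under eq_bigr => v _ do rewrite clique_degree.
rewrite sum_nat_const card_clique_block natrM mulrC mulKf //.
by rewrite pnatr_eq0 -lt0n.
Qed.

(** The colour map is injective on [S]: two vertices of one colour in different blocks would be
    adjacent. *)
Lemma clique_independent_card (S : {set clique_union}) :
  independent S -> #|S| <= m.
Proof.
move=> indS; rewrite -[leqRHS]card_ord.
rewrite -(@card_in_imset _ _ (fun v : clique_union => v.2) S) ?max_card //.
move=> [i c] [j d] xS yS /= eq_cd; subst d.
by have := indS _ _ xS yS; rewrite /= /clique_adj /= eqxx andbT negbK => /eqP->.
Qed.

End CliqueUnion.

Theorem theorem4p17 :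
  forall s D : nat, 1 <= s -> 1 <= D ->
  exists (G : sgraph) (r : nat) (P : 'I_r -> {set G}),
    [/\ multipartition P,
        thick P (s * D),
        max_block_avg_degree P = (D%:R)%R,
        local_degree P = 1
      & ~ exists S : {set G}, independent_transversal_blowup P s S].
Proof.
move=> s D s_gt0 D_gt0; have sD_gt0 : 0 < s * D by rewrite muln_gt0 s_gt0.
exists (clique_union D.+1 (s * D)), D.+1, (@clique_block D.+1 (s * D)).
split.
- exact: clique_multipartition.
- by move=> i; rewrite card_clique_block.
- rewrite /max_block_avg_degree.
  under eq_bigr => i _ do rewrite clique_avg_degree //=.
  rewrite big_const card_ord /=.
  (* The value [D%:R] is generalised to any [d >= 0], so that the induction runs only on the number
     of blocks; the initial 0 is absorbed by [d]. *)
  by elim: D {D_gt0 sD_gt0} (D%:R : rat)%R (ler0n rat D) => [|n IHn] d d_ge0 /=;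
    rewrite ?(Order.TotalTheory.max_idPl d_ge0) ?IHn ?Order.POrderTheory.maxxx.
- apply/eqP; rewrite eqn_leq; apply/andP; split.
    apply/bigmax_leqP=> v _; apply/bigmax_leqP=> i _.
    by rewrite clique_degree_in leq_b1.
  (* A vertex of the first block has a neighbour in the last one; the two blocks differ because
     [D >= 1]. *)
  pose v : clique_union D.+1 (s * D) := (ord0, Ordinal sD_gt0).
  apply: (leq_trans _ (leq_bigmax v)).
  apply: (leq_trans _ (leq_bigmax ord_max)).
  by rewrite clique_degree_in lt0b -val_eqE /= eq_sym -lt0n.
- case=> S [indS cardS]; have := clique_independent_card _ _ S indS.
  rewrite sum_card_clique_block; under eq_bigr => i _ do rewrite cardS.
  by rewrite sum_nat_const card_ord mulnC leq_pmul2l // ltnn.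
Qed.
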